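(* Let $R$ be a right noetherian ring and let $T$ be a tilting module in $\mathrm{Mod}\,R$. Then $$\mathrm{Findim}(R_R)\le \mathrm{pd}\,T+\mathrm{id}\,T.$$
   Context: $R$ is an associative ring with unit and $\mathrm{Mod}\,R$ is the category of all right $R$-modules. $\mathrm{pd}$ and $\mathrm{id}$ denote projective and injective dimension (values in $\{0,1,\dots\}\cup\{\infty\}$). $\mathrm{Findim}(R_R)$ is the supremum of $\mathrm{pd}\,M$ over all right $R$-modules $M$ of finite projective dimension. A (not necessarily finitely generated) module $T\in\mathrm{Mod}\,R$ is a tilting module if: (T1) $\mathrm{pd}\,T<\infty$; (T2) $\mathrm{Ext}^i_R(T,T^{(I)})=0$ for all $i>0$ and all sets $I$, where $T^{(I)}$ is the direct sum of $I$ copies of $T$; (T3) there are $n\ge 0$ and an exact sequence $0\to R_R\to T_0\to T_1\to\cdots\to T_n\to 0$ with every $T_i\in\mathrm{Add}\,T$, where $\mathrm{Add}\,T$ is the class of all modules isomorphic to direct summands of direct sums of copies of $T$. *)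

(* Defs.v *)
From HB Require Import structures.
From mathcomp Require Import all_boot all_algebra.
From mathcomp Require Import boolp classical_sets functions cardinality.

Set Implicit Arguments.
Unset Strict Implicit.
Unset Printing Implicit Defensive.

Import GRing.Theory.
Local Open Scope classical_set_scope.
Local Open Scope ring_scope.

(* MathComp only has left modules.  A right R-module is a left module over the
   converse ring R^c; R_R is (R^c)^o, where [a *: x] is the product [x * a] of
   R.  All the homological notions below are stated for left modules over a
   ring S and are meant to be used with S := R^c. *)
Notation rmodType R := (lmodType R^c).

Section ExtendedNaturals.

(* [None] is infinity. *)
Definition enat := option nat.

Definition ele (x y : enat) : Prop :=
  match x, y with
  | _, None => True
  | None, Some _ => False
  | Some m, Some n => (m <= n)%N
  end.

Definition eadd (x y : enat) : enat :=
  match x, y with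
  | Some m, Some n => Some (m + n)%N
  | _, _ => None
  end.

Definition einf (A : set nat) : enat :=
  match pselect (exists n, `[< A n >]) with
  | left exA => Some (ex_minn exA)
  | right _ => None
  end.

(* The supremum is the least upper bound; that of the empty set is 0. *)
Definition esup (A : set enat) : enat :=
  einf [set n | forall x, A x -> ele x (Some n)].

End ExtendedNaturals.

Section DirectSum.
Variables (S : pzRingType) (I : Type) (T : lmodType S).

Definition fin_support : {pred I -> T} :=
  fun f => `[< finite_set [set i | f i <> 0] >].

Lemma fin_support_submod_closed : GRing.submod_closed fin_support.
Proof.
split=> [|a f g]; rewrite !unfold_in /=.
  apply/asboolP; apply: (@sub_finite_set _ _ set0) => //.
move=> /asboolP finf /asboolP fing; apply/asboolP.
apply: (sub_finite_set _ (_ : finite_set ([set i | f i <> 0] `|` [set i | g i <> 0]))).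
  move=> i /= nz; apply: contrapT => /not_orP[/contrapT f0 /contrapT g0].
  by apply: nz; change (a *: f i + g i = 0); rewrite f0 g0 scaler0 add0r.
by rewrite finite_setU.
Qed.

HB.instance Definition _ :=
  GRing.isSubmodClosed.Build S (I -> T) fin_support fin_support_submod_closed.

(* The direct sum of copies of T indexed by I: finitely supported families. *)
Record dsum := DSum { dsum_fun :> I -> T; _ : dsum_fun \in fin_support }.

HB.instance Definition _ := [isSub for dsum_fun].
HB.instance Definition _ := [Choice of dsum by <:].
HB.instance Definition _ := [SubChoice_isSubLmodule of dsum by <:].

End DirectSum.

Section Homological.
Variable S : pzRingType.
Implicit Types M N T P E : lmodType S.

Definition zero_module M : Prop := forall x : M, x = 0.

Definition projective P : Prop :=
  forall (A B : lmodType S) (g : {linear A -> B}) (f : {linear P -> B}),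
    (forall b, exists a, g a = b) ->
    exists h : {linear P -> A}, forall x, g (h x) = f x.

Definition injective_module E : Prop :=
  forall (A B : lmodType S) (g : {linear A -> B}) (f : {linear A -> E}),
    injective g ->
    exists h : {linear B -> E}, forall x, h (g x) = f x.

(* An exact sequence ... -> C_1 -> C_0 -> M -> 0. *)
Record resolution M := Resolution {
  res_obj :> nat -> lmodType S;
  res_diff : forall i, {linear res_obj i.+1 -> res_obj i};
  res_aug : {linear res_obj 0%N -> M};
  res_aug_surj : forall m, exists x, res_aug x = m;
  res_exact0 : forall x, res_aug x = 0 <-> exists y, res_diff 0%N y = x;
  res_exactS : forall i x,
    res_diff i x = 0 <-> exists y, res_diff i.+1 y = x }.

(* An exact sequence 0 -> M -> C_0 -> C_1 -> ... *)
Record coresolution M := Coresolution {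
  cores_obj :> nat -> lmodType S;
  cores_diff : forall i, {linear cores_obj i -> cores_obj i.+1};
  cores_aug : {linear M -> cores_obj 0%N};
  cores_aug_inj : injective cores_aug;
  cores_exact0 : forall x, cores_diff 0%N x = 0 <-> exists m, cores_aug m = x;
  cores_exactS : forall i x,
    cores_diff i.+1 x = 0 <-> exists y, cores_diff i y = x }.

Definition vanishes_above n (C : nat -> lmodType S) : Prop :=
  forall i, (n < i)%N -> zero_module (C i).

Definition pd M : enat :=
  einf [set n | exists X : resolution M,
    (forall i, projective (X i)) /\ vanishes_above n X].

Definition id_dim M : enat :=
  einf [set n | exists X : coresolution M,
    (forall i, injective_module (X i)) /\ vanishes_above n X].

Definition findim : enat :=
  esup [set d | exists2 M : lmodType S, pd M <> None & d = pd M].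

Definition hom_cocycle M N (X : resolution M) i (f : {linear X i -> N}) : Prop :=
  forall y, f (res_diff X i y) = 0.

Definition hom_coboundary M N (X : resolution M) i :
    {linear X i -> N} -> Prop :=
  match i with
  | 0%N => fun f => forall x, f x = 0
  | j.+1 => fun f =>
      exists g : {linear X j -> N}, forall x, f x = g (res_diff X j x)
  end.

(* Ext^i(M, N) = 0: the i-th cohomology of Hom(X, N) is zero for the projective
   resolutions X of M (which of them is used does not matter, by the
   comparison theorem). *)
Definition Ext_vanishes i M N : Prop :=
  forall X : resolution M, (forall j, projective (X j)) ->
  forall f : {linear X i -> N}, hom_cocycle f -> hom_coboundary f.

Definition Add T M : Prop :=
  exists (I : Type) (N : lmodType S) (f : {linear (M * N)%type -> dsum I T}),
    bijective f.

(* In the third clause the sequence 0 -> S -> T_0 -> ... -> T_n -> 0 is encoded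
   as a coresolution which is zero beyond degree n. *)
Definition tilting T : Prop :=
  [/\ pd T <> None,
      forall (i : nat) (I : Type), (0 < i)%N -> Ext_vanishes i T (dsum I T)
    & exists (n : nat) (X : coresolution S^o),
        vanishes_above n X /\ forall i, (i <= n)%N -> Add T (X i)].

End Homological.

Section Noetherian.
Variable R : pzRingType.

Definition right_ideal (A : set R) : Prop :=
  [/\ A 0, forall x y, A x -> A y -> A (x + y)
    & forall x r, A x -> A (x * r)].

Definition right_noetherian : Prop :=
  forall A : nat -> set R,
    (forall n, right_ideal (A n)) -> (forall n, A n `<=` A n.+1) ->
    exists m, forall n, (m <= n)%N -> A n = A m.

End Noetherian.

(* Main.v *)
(* Let n = pd T and m = id T be finite.  Dimension shifting along
   0 -> R -> T_0 -> ... -> T_k -> 0, together with Ext^i(T, T^(I)) = 0 for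
   i > 0, shows that the sequence can be cut down to k <= n: when k > n, its
   last map splits.  As R is right noetherian, direct sums of injectives are
   injective, so every module in Add T has injective dimension at most m.
   Taking direct sums of the coresolution of R, every free module, hence every
   projective module F, satisfies Ext^i(M, F) = 0 for all M and all i > m + n.
   If pd M is finite, this forces the (m + n)-th syzygy N of M to be
   projective: by induction on pd N the first syzygy K of N is projective, and
   Ext^1(N, K) = 0 splits K off. *)
From HB Require Import structures.
From mathcomp Require Import all_boot all_algebra.
From mathcomp Require Import boolp classical_sets functions cardinality fsbigop.
Require Import Defs.
Set Implicit Arguments.
Unset Strict Implicit.
Unset Printing Implicit Defensive.

Import GRing.Theory.
Local Open Scope classical_set_scope.
Local Open Scope ring_scope.

(** * Submodules and linear maps defined by choice *)

Definition pack_linear (S : pzRingType) (A B : lmodType S) (f : A -> B)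
    (fL : linear f) : {linear A -> B} :=
  HB.pack f (GRing.isLinear.Build S A B _ f fL).

(** Bundling the closure proof with the set lets each submodule carry a module type of its own. *)
Record submodule (S : pzRingType) (V : lmodType S) := Submodule {
  submod_set :> V -> Prop;
  submod_closedP : GRing.submod_closed (fun x => `[< submod_set x >]) }.

Section Submodules.
Variables (S : pzRingType) (V : lmodType S) (P : submodule V).

Definition submod_pred : {pred V} := fun x => `[< P x >].

HB.instance Definition _ :=
  GRing.isSubmodClosed.Build S V submod_pred (submod_closedP P).

Record submod_type := SubmodType { submod_val : V; _ : submod_val \in submod_pred }.

HB.instance Definition _ := [isSub for submod_val].
HB.instance Definition _ := [Choice of submod_type by <:].
HB.instance Definition _ := [SubChoice_isSubLmodule of submod_type by <:].

Lemma submod_val_linear : linear submod_val.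
Proof. by []. Qed.

Definition submod_incl : {linear submod_type -> V} := pack_linear submod_val_linear.

Lemma submod_incl_inj : injective submod_incl.
Proof. exact: val_inj. Qed.

Lemma submod_inclP x : P x <-> exists y, submod_incl y = x.
Proof.
split=> [Px | [[y Py] <-]]; last exact/asboolP.
have Px' : x \in submod_pred by apply/asboolP.
by exists (SubmodType Px').
Qed.

End Submodules.

Lemma submoduleE (S : pzRingType) (V : lmodType S) (P : set V) :
  P 0 -> (forall a x y, P x -> P y -> P (a *: x + y)) ->
  exists Q : submodule V, Q = P :> (V -> Prop).
Proof.
move=> P0 PL.
have cl : GRing.submod_closed (fun x => `[< P x >]).
  split; first exact/asboolP.
  by move=> a x y /asboolP Px /asboolP Py; apply/asboolP/PL.
by exists (Submodule cl).
Qed.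

Section LinearMaps.
Variable S : pzRingType.
Implicit Types A B C : lmodType S.

Lemma corestriction A B C (i : {linear A -> B}) (g : {linear C -> B}) :
  injective i -> (forall x, exists a, i a = g x) ->
  exists h : {linear C -> A}, forall x, i (h x) = g x.
Proof.
move=> inji /choice[h hE].
have hL : linear h by move=> a x y; apply: inji; rewrite linearP !hE linearP.
by exists (pack_linear hL).
Qed.

Lemma factor_surjection A B C (p : {linear B -> C}) (g : {linear B -> A}) :
  (forall c, exists b, p b = c) -> (forall b, p b = 0 -> g b = 0) ->
  exists h : {linear C -> A}, forall b, h (p b) = g b.
Proof.
move=> /choice[s sE] pg.
have gE b b' : p b = p b' -> g b = g b'.
  move=> e; apply/eqP; rewrite -subr_eq0 -linearB pg ?eqxx //.
  by rewrite linearB e subrr.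
have hL : linear (g \o s).
  by move=> a x y /=; rewrite -linearP; apply: gE; rewrite linearP !sE.
by exists (pack_linear hL) => b; apply: gE; rewrite sE.
Qed.

End LinearMaps.

(** * Direct sums of copies of a module *)

Section DirectSums.
Variables (S : pzRingType) (I : Type).
Implicit Types A B C : lmodType S.

Lemma dsum_finite A (x : dsum I A) : finite_set [set i | x i <> 0].
Proof. by case: x => x /= /asboolP. Qed.

Lemma dsum_ext A (x y : dsum I A) : (forall i, x i = y i) -> x = y.
Proof. by move=> xy; apply: val_inj; apply: funext. Qed.

Lemma dsum_exists A (f : I -> A) : finite_set [set i | f i <> 0] ->
  exists x : dsum I A, forall i, x i = f i.
Proof.
move=> finf; have fP : f \in @fin_support S I A by apply/asboolP.
by exists (DSum fP).
Qed.

Definition delta_fun A (i : I) (a : A) (j : I) : A :=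
  if `[< j = i >] then a else 0.

Lemma delta_fun_fin A i (a : A) : delta_fun i a \in @fin_support S I A.
Proof.
apply/asboolP/(@sub_finite_set _ _ [set i]); last exact: finite_set1.
by move=> j; rewrite /= /delta_fun; case: asboolP.
Qed.

Definition dsum_delta A i (a : A) : dsum I A := DSum (delta_fun_fin i a).

Lemma dsum_delta_linear A i : linear (@dsum_delta A i).
Proof.
move=> a x y; apply: dsum_ext => j.
change (delta_fun i (a *: x + y) j = a *: delta_fun i x j + delta_fun i y j).
by rewrite /delta_fun; case: asboolP => //; rewrite scaler0 add0r.
Qed.

Lemma dsum_linear_ext A B (f g : {linear dsum I A -> B}) :
  (forall i a, f (dsum_delta i a) = g (dsum_delta i a)) -> forall x, f x = g x.
Proof.
move=> fg x.
(* [{classic I}] supplies the equality test needed to list the finite support; the induction then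
   removes one coordinate at a time. *)
have [s sx] : exists s : seq {classic I}, forall i, x i <> 0 -> i \in s.
  have /finite_seqP[s sE] : finite_set [set i : {classic I} | x i <> 0].
    exact: dsum_finite.
  by exists s => i xi; have : [set` s] i by rewrite -sE.
elim: s x sx => [|i s IHs] x sx.
  suff -> : x = 0 by rewrite !linear0.
  by apply: dsum_ext => i; apply: contrapT => /sx.
rewrite -[x](subrK (dsum_delta i (x i))) [LHS]linearD [RHS]linearD fg; congr (_ + _).
apply: IHs => j.
change (x j - delta_fun i (x i) j <> 0 -> j \in s).
rewrite /delta_fun; case: asboolP => [->|ji]; first by rewrite subrr.
by rewrite subr0 => /sx /predU1P[].
Qed.

Lemma dsum_copair A B (g : I -> {linear A -> B}) :
  exists h : {linear dsum I A -> B}, forall i a, h (dsum_delta i a) = g i a.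
Proof.
pose h (x : dsum I A) : B := \sum_(i \in [set: {classic I}]) g i (x i).
(* The sum may run over any duplicate-free list containing the support, so [x], [y] and [a *: x + y]
   can share one list. *)
have hE (x : dsum I A) (s : seq {classic I}) :
    uniq s -> (forall i, x i <> 0 -> i \in s) -> h x = \sum_(i <- s) g i (x i).
  move=> us xs; rewrite /h (fsbigE s) => [||i _|i _ /negP nis] //.
    by apply: eq_bigl => i; rewrite in_setT.
  have -> : x i = 0 by apply: contrapT => /xs.
  by rewrite linear0.
have hL : linear h.
  move=> a x y.
  have /finite_seqP[s sE] : finite_set
      ([set i : {classic I} | x i <> 0] `|` [set i | y i <> 0]).
    by rewrite finite_setU; split; apply: dsum_finite.
  have sP (i : {classic I}) : x i <> 0 \/ y i <> 0 -> i \in undup s.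
    by move=> xy; rewrite mem_undup; have : [set` s] i by rewrite -sE.
  rewrite !(hE _ (undup s)) ?undup_uniq //.
  - by rewrite scaler_sumr -big_split; apply: eq_bigr => i _; exact: linearP.
  - by move=> i yi; apply: sP; right.
  - by move=> i xi; apply: sP; left.
  - move=> i xyi; apply: sP; apply: contrapT => /not_orP[/contrapT xi /contrapT yi].
    by apply: xyi; change (a *: x i + y i = 0); rewrite xi yi scaler0 addr0.
exists (pack_linear hL) => i a.
rewrite [LHS](hE _ [:: i : {classic I}]) //= ?big_seq1 => [|j].
  by rewrite /dsum_delta /= /delta_fun asboolT.
by rewrite /dsum_delta /= /delta_fun; case: asboolP => // -> _; apply/predU1P; left.
Qed.

Lemma dsum_map A B (g : {linear A -> B}) :
  exists h : {linear dsum I A -> dsum I B}, forall x i, h x i = g (x i).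
Proof.
have /choice[h hE] : forall x : dsum I A,
    exists y : dsum I B, forall i, y i = g (x i).
  move=> x; apply: dsum_exists; apply: sub_finite_set (dsum_finite x) => i /=.
  by apply: contra_not => ->; rewrite linear0.
have hL : linear h.
  move=> a x y; apply: dsum_ext => i; rewrite hE.
  change (g (a *: x i + y i) = a *: h x i + h y i).
  by rewrite !hE linearP.
by exists (pack_linear hL).
Qed.

End DirectSums.

(** * Short exact sequences and finite coresolutions *)

Section ExactSequences.
Variable S : pzRingType.
Implicit Types A B C E M N T : lmodType S.

Definition exact_at A B C (i : {linear A -> B}) (p : {linear B -> C}) : Prop :=
  forall x, p x = 0 <-> exists a, i a = x.

Definition ses A B C : Prop :=
  exists (i : {linear A -> B}) (p : {linear B -> C}),
    [/\ injective i, forall c, exists b, p b = c & exact_at i p].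

Definition retract A B : Prop :=
  exists (u : {linear A -> B}) (v : {linear B -> A}), forall x, v (u x) = x.

Lemma retract_trans A B C : retract A B -> retract B C -> retract A C.
Proof.
move=> [u [v vu]] [u' [v' vu']].
by exists (u' \o u), (v \o v') => x /=; rewrite vu' vu.
Qed.

Lemma retract_dsum I A B : retract A B -> retract (dsum I A) (dsum I B).
Proof.
move=> [u [v vu]].
have [U UE] := dsum_map I u; have [V VE] := dsum_map I v.
by exists U, V => x; apply: dsum_ext => i; rewrite VE UE vu.
Qed.

Lemma ses_dsum I A B C : ses A B C -> ses (dsum I A) (dsum I B) (dsum I C).
Proof.
move=> [i [p [inji surjp ex]]].
have [i' i'E] := dsum_map I i; have [p' p'E] := dsum_map I p.
exists i', p'; split.
- move=> x y xy; apply: dsum_ext => j; apply: inji.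
  by rewrite -!i'E xy.
- move=> z; have [s sE] := choice surjp.
  (* The chosen preimage [s 0] may be nonzero, so 0 is put wherever [z] vanishes to keep the support
     finite. *)
  have [] := @dsum_exists S I B (fun j => if `[< z j = 0 >] then 0 else s (z j)).
    apply: sub_finite_set (dsum_finite z) => j /=.
    by case: asboolP.
  move=> x xE; exists x; apply: dsum_ext => j; rewrite p'E xE.
  by case: asboolP => [->|]; rewrite ?linear0.
- move=> x; split=> [x0 | [a <-]]; last first.
    apply: dsum_ext => j; rewrite p'E i'E; apply/ex; by exists (a j).
  have /choice[f fE] : forall j, exists a, i a = x j.
    by move=> j; apply/ex; rewrite -p'E x0.
  have [] := @dsum_exists S I A f.
    apply: sub_finite_set (dsum_finite x) => j /=.
    by rewrite -fE => fj0 ifj0; apply/fj0/inji; rewrite linear0.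
  by move=> a aE; exists a; apply: dsum_ext => j; rewrite i'E aE.
Qed.

(** The map [id - s p] lands in the kernel of [p], so it corestricts to a retraction of [i]. *)
Lemma ses_retract A B C (i : {linear A -> B}) (p : {linear B -> C})
    (s : {linear C -> B}) :
  injective i -> exact_at i p -> (forall c, p (s c) = c) -> retract A B.
Proof.
move=> inji ex ps.
have [] := @corestriction S A B B i (idfun \- (s \o p)) inji.
  by move=> x; apply/ex; rewrite linearB /= ps subrr.
move=> r rE; exists i, r => a; apply: inji; rewrite rE /=.
suff -> : p (i a) = 0 by rewrite linear0 subr0.
by apply/ex; exists a.
Qed.

(* N has a coresolution 0 -> N -> B_0 -> ... -> B_n -> 0 with all B_i in P
   (P has to be closed under isomorphism for this reading). *)
Fixpoint cores (P : lmodType S -> Prop) (n : nat) N : Prop :=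
  match n with
  | 0 => P N
  | n'.+1 => exists B C, [/\ ses N B C, P B & cores P n' C]
  end.

Lemma cores_dsum (P Q : lmodType S -> Prop) I n N :
  (forall M, P M -> Q (dsum I M)) -> cores P n N -> cores Q n (dsum I N).
Proof.
move=> PQ; elim: n N => [|n IHn] N /=; first exact: PQ.
move=> [B [C [sNBC PB /IHn cC]]]; exists (dsum I B), (dsum I C).
by split=> //; [exact: ses_dsum | exact: PQ].
Qed.

(** The kernel [K] of the second differential is the image of the first; this cuts off a short exact
    sequence and leaves a shifted coresolution of [K]. In length 0 the augmentation is bijective,
    and closure under retracts moves [P] to [N]. *)
Lemma coresolution_cores (P : lmodType S -> Prop) n N (X : coresolution N) :
  (forall A B, retract A B -> P B -> P A) ->
  (forall i, (i <= n)%N -> P (X i)) -> vanishes_above n X -> cores P n N.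
Proof.
move=> Pr; elim: n N X => [|n IHn] N X PX vX.
  have d0 x : cores_diff X 0%N x = 0 by apply: vX.
  have [] := @corestriction S N (X 0%N) (X 0%N) (cores_aug X) idfun.
  - exact: cores_aug_inj.
  - by move=> x; apply/cores_exact0.
  move=> r rE /=; apply: Pr (PX 0%N _) => //; exists (cores_aug X), r => x.
  by apply: (@cores_aug_inj _ _ X); rewrite rE.
have [] := @submoduleE S (X 1%N) (fun x => cores_diff X 1%N x = 0).
- exact: linear0.
- by move=> a x y x0 y0; rewrite linearP x0 y0 scaler0 addr0.
move=> K KE; have KP x : cores_diff X 1%N x = 0 <-> exists k : submod_type K, submod_incl K k = x.
  by rewrite -submod_inclP KE.
pose Y := @Coresolution S (submod_type K) (fun i => X i.+1)
  (fun i => cores_diff X i.+1) (submod_incl K) (@submod_incl_inj _ _ K) KP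
  (fun i => @cores_exactS _ _ X i.+1).
exists (X 0%N), (submod_type K); split; [ | exact: PX | ].
  have [] := @corestriction S (submod_type K) (X 1%N) (X 0%N) (submod_incl K)
    (cores_diff X 0%N) (@submod_incl_inj _ _ K).
    by move=> x; apply/KP/cores_exactS; exists x.
  move=> p pE; exists (cores_aug X), p; split; first exact: cores_aug_inj.
  - move=> k; have /cores_exactS[x xE] : cores_diff X 1%N (submod_incl K k) = 0.
      by apply/KP; exists k.
    by exists x; apply: (@submod_incl_inj _ _ K); rewrite pE.
  - move=> x; rewrite -cores_exact0 -pE; split=> [->|]; first by rewrite linear0.
    by move=> e; apply: (@submod_incl_inj _ _ K); rewrite e linear0.
by apply: (IHn _ Y) => i; [exact: (PX i.+1) | exact: (vX i.+1)].
Qed.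

End ExactSequences.

(** * Injective modules and Baer's criterion *)

Section Injectives.
Variable S : pzRingType.
Implicit Types A B E : lmodType S.

Lemma injective_retract A B : retract A B -> injective_module B -> injective_module A.
Proof.
move=> [u [v vu]] injB C D g f injg.
have [h hE] := injB C D g (u \o f) injg.
by exists (v \o h) => x; rewrite /= hE /= vu.
Qed.

(** For a submodule [G] this says that [G] is the graph of a linear map defined on a submodule of
    [A]. *)
Definition functional A E (G : A * E -> Prop) : Prop :=
  forall e, G (0, e) -> e = 0.

(** Being functional makes the first projection of [G] injective; the second projection is extended
    along it. *)
Lemma injective_graph B E (G : submodule (B * E)%type) :
  injective_module E -> functional G ->
  exists h : {linear B -> E}, forall b e, G (b, e) -> h b = e.
Proof.
move=> injE Gf; pose i := submod_incl G.
have iG x : G (i x) by apply/submod_inclP; exists x.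
have [|h hE] := injE (submod_type G) B (fst \o i) (snd \o i).
  move=> x y /= e; apply/eqP; rewrite -subr_eq0.
  apply/eqP/(@submod_incl_inj _ _ G); rewrite linear0 -/i.
  have e1 : (i (x - y)).1 = 0 by rewrite linearB /= e subrr.
  have e2 : (i (x - y)).2 = 0.
    by apply: Gf; rewrite -e1 -surjective_pairing.
  by rewrite [LHS]surjective_pairing e1 e2.
exists h => b e /submod_inclP[x xE].
by move: (hE x); rewrite /= -/i in xE *; rewrite xE.
Qed.

Lemma injective_factor A B E (g : {linear A -> B}) (f : {linear A -> E}) :
  injective_module E -> (forall a, g a = 0 -> f a = 0) ->
  exists h : {linear B -> E}, forall a, h (g a) = f a.
Proof.
move=> injE gf.
have [] := @submoduleE S (B * E)%type (fun z => exists a, z = (g a, f a)).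
- by exists 0; rewrite !linear0.
- by move=> a x y [b ->] [c ->]; exists (a *: b + c); rewrite !linearP.
move=> G GE; have [|h hE] := @injective_graph B E G injE.
  by move=> e; rewrite GE => -[a [/esym/gf fa ->]].
by exists h => a; apply: hE; rewrite GE; exists a.
Qed.

(* The homomorphisms from left ideals of S to E are encoded by their graphs. *)
Lemma baer_criterion E :
  (forall H : submodule (S^o * E)%type, functional H ->
     exists e0 : E, forall (s : S) e, H (s, e) -> e = s *: e0) ->
  injective_module E.
Proof.
move=> baer A B g f injg.
pose G0 : set (B * E) := [set z | exists a, z = (g a, f a)].
pose good (Y : set (B * E)) := [/\ Y 0, forall a x y, Y x -> Y y -> Y (a *: x + y)
  & functional Y].
(* Goodness is asked of [G0]|[X] rather than of [X], so that the empty chain, whose union is empty,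
   also satisfies it. *)
have [|X [goodG maxX]] := @Zorn_bigcup _ [set X | good (G0 `|` X)].
  move=> F FP Ftot.
  have [[X0 FX0]|F0] := pselect (exists X, F X); last first.
    have -> : \bigcup_(X in F) X = set0.
      by apply/seteqP; split=> // z [X FX]; case: F0; exists X.
    rewrite /= setU0; split.
    - by exists 0; rewrite !linear0.
    - by move=> a x y [b ->] [c ->]; exists (a *: b + c); rewrite !linearP.
    - move=> e [a [/esym ga ->]].
      have -> : a = 0 by apply: injg; rewrite ga linear0.
      exact: linear0.
  have in_one z : (G0 `|` \bigcup_(X in F) X) z -> exists2 X, F X & (G0 `|` X) z.
    case=> [z0|[X FX Xz]]; first by exists X0 => //; left.
    by exists X => //; right.
  have in_all X z : F X -> (G0 `|` X) z -> (G0 `|` \bigcup_(X in F) X) z.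
    by move=> FX [z0|Xz]; [left | right; exists X].
  split.
  - by apply: (in_all _ _ FX0); have [] := FP _ FX0.
  - move=> a x y /in_one[X FX Xx] /in_one[Y FY Yy].
    have [Z [FZ Zx Zy]] : exists Z, [/\ F Z, (G0 `|` Z) x & (G0 `|` Z) y].
      have [XY|YX] := Ftot _ _ FX FY.
        by exists Y; split=> //; case: Xx => [|/XY]; [left|right].
      by exists X; split=> //; case: Yy => [|/YX]; [left|right].
    by apply: (in_all _ _ FZ); have [_ ZL _] := FP _ FZ; apply: ZL.
  - by move=> e /in_one[X FX Xe]; have [_ _] := FP _ FX; apply.
pose G := G0 `|` X; have [G_0 GL Gf] : good G by [].
have Gtot b : exists e, G (b, e).
  apply: contrapT => Gb.
  (* This is the graph of the partial map [s |-> G(s b)] on the left ideal of all [s] with [s b] in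
     the domain of [G]. *)
  have [] := @submoduleE S (S^o * E)%type (fun z => G ((z.1 : S) *: b, z.2)).
  - by rewrite /= scale0r.
  - move=> a [s x] [t y] /= Gx Gy.
    have := GL a _ _ Gx Gy; congr G; congr (_, _).
    by rewrite /= scalerDl scalerA.
  move=> H HE; have [|e0 e0E] := baer H.
    by move=> e; rewrite HE /= scale0r; apply: Gf.
  rewrite HE /= in e0E.
  (* [G'] extends the partial map to [b] by the value [e0], against the maximality of [X]. *)
  pose G' : set (B * E) := [set z | exists (s : S) x, G x /\ z = x + s *: (b, e0)].
  have GG' : G `<=` G' by move=> z Gz; exists 0, z; rewrite scale0r addr0.
  apply: (maxX G').
    split; first by move=> z Xz; apply: GG'; right.
    move=> G'X; apply: Gb; exists e0; right; apply: G'X.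
    by exists 1, 0; rewrite scale1r add0r.
  rewrite /=; have -> : G0 `|` G' = G' by apply/setUidPr => z z0; apply: GG'; left.
  split; first exact: GG'.
  - move=> a x y [s [x' [Gx ->]]] [t [y' [Gy ->]]].
    exists (a * s + t), (a *: x' + y'); split; first exact: GL.
    by rewrite scalerDr scalerDl scalerA addrACA.
  - move=> e [s [[x y] [Gxy [/= /esym/eqP xE ->]]]].
    (* From [x = - s b] the pair [(s b, - y)] lies in [G], so [- y = s e0] and the value [y + s e0]
       is 0. *)
    rewrite addr_eq0 in xE; move/eqP: xE => xE.
    suff /e0E : G (s *: b, - y) by move=> <-; rewrite subrr.
    have := GL (-1) _ _ Gxy G_0; congr G.
    by rewrite addr0 scaleN1r xE; congr (_, _); rewrite /= opprK.
have /choice[h hG] := Gtot.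
have Guniq b e e' : G (b, e) -> G (b, e') -> e = e'.
  move=> Ge Ge'; apply/eqP; rewrite -subr_eq0; apply/eqP/Gf.
  have := GL (-1) _ _ Ge' Ge; congr G.
  by rewrite scaleN1r; congr (_, _); rewrite /= addrC ?subrr.
have hL : linear h.
  by move=> a x y; apply: Guniq (hG _) _; apply: (GL a (_, _) (_, _)).
exists (pack_linear hL) => a; apply: Guniq (hG _) _.
by left; exists a.
Qed.

End Injectives.

(* A homomorphism from a right ideal to a direct sum has image in a finite
   subsum: otherwise the preimages of an increasing sequence of finite subsums
   would form a strictly increasing chain of right ideals. *)
Lemma injective_dsum (R : pzRingType) (I : Type) (E : rmodType R) :
  right_noetherian R -> injective_module E -> injective_module (dsum I E).
Proof.
move=> noethR injE; apply: baer_criterion => H Hf.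
have [H0 HL] : H 0 /\ forall a x y, H x -> H y -> H (a *: x + y).
  have [H0 HL] := submod_closedP H; split; first exact/asboolP.
  by move=> a x y Hx Hy; apply/asboolP/HL; exact/asboolP.
pose supp (x : dsum I E) : set I := [set i | x i <> 0].
(* [c J] is an element of the graph whose value has support not inside [J], whenever one exists;
   otherwise it is 0. *)
have /choice[c cP] : forall J : set I, exists z, H z /\
    ((exists z', H z' /\ ~ supp z'.2 `<=` J) -> ~ supp z.2 `<=` J).
  move=> J; have [[z [Hz zJ]]|no] := pselect (exists z, H z /\ ~ supp z.2 `<=` J).
    by exists z.
  by exists 0; split=> // /no.
pose J k := iter k (fun L => L `|` supp (c L).2) set0.
have Jfin k : finite_set (J k).
  elim: k => [|k IHk]; first exact: finite_set0.
  by rewrite /= finite_setU; split=> //; apply: dsum_finite.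
pose A k : set R := [set s | exists2 x, H (s : R^c^o, x) & supp x `<=` J k].
have [||m mA] := noethR A.
- move=> k; split.
  + by exists 0.
  + move=> s t [x Hx xJ] [y Hy yJ]; exists (x + y).
      by have := HL 1 _ _ Hx Hy; rewrite scale1r.
    move=> i xyi; apply: contrapT => Ji; apply: xyi.
    rewrite [LHS](_ : _ = x i + y i) //.
    have -> : x i = 0 by apply: contrapT => /xJ.
    have -> : y i = 0 by apply: contrapT => /yJ.
    by rewrite addr0.
  + move=> s r [x Hx xJ]; exists ((r : R^c) *: x).
      by have := HL (r : R^c) _ _ Hx H0; rewrite addr0.
    move=> i rxi; apply: xJ => xi; apply: rxi.
    by rewrite [LHS](_ : _ = (r : R^c) *: x i) // xi scaler0.
- by move=> k s [x Hx xJ]; exists x => // i /xJ; left.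
(* Were [J m] too small, the argument of [c (J m)] would lie in [A m.+1], hence in [A m]; since [H]
   is functional, its value would then be supported in [J m]. *)
have HJ s x : H (s, x) -> supp x `<=` J m.
  move=> Hx; apply: contrapT => xJ.
  have [Hc cJ] := cP (J m).
  have {cJ} := cJ (ex_intro _ (s, x) (conj Hx xJ)).
  move: Hc; case cE: (c (J m)) => [t y] /= Hy; apply.
  have : A m t.
    rewrite -(mA m.+1) //; exists y => //= i yi; right.
    by rewrite /= -/(J m) cE.
  move=> [y' Hy' y'J].
  suff -> : y = y' by [].
  apply/eqP; rewrite -subr_eq0; apply/eqP/Hf.
  have := HL (-1) _ _ Hy' Hy; congr (H _).
  by rewrite scaleN1r; congr (_, _); rewrite /= addrC ?subrr.
(* Each coordinate map extends to all of the ring, hence is scaling of the image of 1. *)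
have /choice[e eP] : forall i, exists e : E, forall (s : R^c) x, H (s, x) -> x i = s *: e.
  move=> i.
  have [] := @submoduleE R^c (R^c^o * E)%type (fun z => exists2 x, H (z.1, x) & x i = z.2).
  - by exists 0.
  - move=> a [s _] [t _] [x /= Hx <-] [y /= Hy <-].
    by exists (a *: x + y) => //; apply: (HL a (_, _) (_, _)).
  move=> G GE; have [|h hE] := injective_graph (G := G) injE.
    by move=> e; rewrite GE /= => -[x /Hf -> <-].
  exists (h 1) => s x Hx; rewrite -linearZ_LR.
  rewrite [s *: _](_ : _ = s) ?mulr1; last exact: (@mulr1 R^c).
  by symmetry; apply: hE; rewrite GE; exists x.
have [] := @dsum_exists R^c I E (fun i => if `[< J m i >] then e i else 0).
  by apply: sub_finite_set (Jfin m) => i /=; case: asboolP.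
move=> e0 e0E; exists e0 => s x Hx; apply: dsum_ext => i.
rewrite [RHS](_ : _ = s *: e0 i) // e0E; case: asboolP => Ji.
  exact: eP.
by rewrite scaler0; apply: contrapT => /(HJ _ _ Hx).
Qed.

(** * Vanishing of Ext and dimension shifting *)

Section Cohomology.
Variable S : pzRingType.
Implicit Types A B C E F K M N T : lmodType S.

Definition projective_terms M (X : resolution M) : Prop :=
  forall i, projective (X i).

(* Ext^i(M, N) = 0 computed with the given resolution X, for i > 0; keeping X
   fixed dispenses with the comparison theorem. *)
Definition acyclic M (X : resolution M) i N : Prop :=
  forall f : {linear X i -> N}, hom_cocycle f -> hom_coboundary f.

Lemma res_diffK M (X : resolution M) i x :
  res_diff X i (res_diff X i.+1 x) = 0.
Proof. by apply/res_exactS; exists x. Qed.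

Lemma acyclic_injective M (X : resolution M) E i :
  injective_module E -> acyclic X i.+1 E.
Proof.
move=> injE f fd.
have [|h hE] := injective_factor (g := res_diff X i) (f := f) injE.
  by move=> x /res_exactS[y <-].
by exists h => x; rewrite hE.
Qed.

Lemma acyclic_retract M (X : resolution M) A B i :
  retract A B -> acyclic X i.+1 B -> acyclic X i.+1 A.
Proof.
move=> [u [v vu]] acB f fd.
have [|g gE] := acB (u \o f); first by move=> y; rewrite /= fd linear0.
by exists (v \o g) => x; rewrite /= -gE /= vu.
Qed.

(** Exactness of Ext^{i+1}(M, C) -> Ext^{i+2}(M, A) -> Ext^{i+2}(M, B) at the middle term. *)
Lemma acyclic_sub M (X : resolution M) A B C i : projective_terms X ->
  ses A B C -> acyclic X i.+1 C -> acyclic X i.+2 B -> acyclic X i.+2 A.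
Proof.
move=> projX [j [p [injj surjp ex]]] acC acB f fd.
have [|g gE] := acB (j \o f); first by move=> y; rewrite /= fd linear0.
have [|h hE] := acC (p \o g).
  by move=> y; rewrite /= -gE; apply/ex; exists (f y).
have [h' h'E] := projX i B C p h surjp.
have [] := @corestriction S A B (X i.+1) j (g \- (h' \o res_diff X i)) injj.
  by move=> x; apply/ex; rewrite linearB /= h'E -hE subrr.
move=> k kE; exists k => x; apply: injj; rewrite kE /= res_diffK linear0 subr0.
by rewrite -gE.
Qed.

(** Exactness of Ext^{i+1}(M, B) -> Ext^{i+1}(M, C) -> Ext^{i+2}(M, A) at the middle term. *)
Lemma acyclic_quotient M (X : resolution M) A B C i : projective_terms X ->
  ses A B C -> acyclic X i.+1 B -> acyclic X i.+2 A -> acyclic X i.+1 C.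
Proof.
move=> projX [j [p [injj surjp ex]]] acB acA f fd.
have [f' f'E] := projX i.+1 B C p f surjp.
have [] := @corestriction S A B (X i.+2) j (f' \o res_diff X i.+1) injj.
  by move=> x; apply/ex; rewrite /= f'E fd.
move=> k kE; have [|g gE] := acA k.
  by move=> y; apply: injj; rewrite kE /= res_diffK !linear0.
have [|h hE] := acB (f' \- (j \o g)).
  by move=> y; rewrite /= -gE kE /= subrr.
exists (p \o h) => x; rewrite /= -hE linearB /= f'E.
suff -> : p (j (g x)) = 0 by rewrite subr0.
by apply/ex; exists (g x).
Qed.

(** The obstruction to lifting [f] is a class in Ext^1(M, A): a lift [h] on [X 0] is corrected by
    [j g] until it kills the image of the differential and descends to [M]. *)
Lemma acyclic_lift M (X : resolution M) A B C (j : {linear A -> B})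
    (p : {linear B -> C}) : projective_terms X -> injective j ->
  (forall c, exists b, p b = c) -> exact_at j p -> acyclic X 1 A ->
  forall f : {linear M -> C}, exists g : {linear M -> B}, forall x, p (g x) = f x.
Proof.
move=> projX injj surjp ex acA f.
have [h hE] := projX 0%N B C p (f \o res_aug X) surjp.
have augd x : res_aug X (res_diff X 0 x) = 0 by apply/res_exact0; exists x.
have [] := @corestriction S A B (X 1%N) j (h \o res_diff X 0%N) injj.
  by move=> x; apply/ex; rewrite /= hE /= augd linear0.
move=> k kE; have [|g gE] := acA k.
  by move=> y; apply: injj; rewrite kE /= res_diffK !linear0.
have [] := @factor_surjection S B (X 0%N) M (res_aug X) (h \- (j \o g)).
- exact: res_aug_surj.
- by move=> b /res_exact0[y <-]; rewrite /= -gE kE /= subrr.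
move=> q qE; exists q => m; have [x <-] := res_aug_surj X m.
rewrite qE linearB /= hE /=.
suff -> : p (j (g x)) = 0 by rewrite subr0.
by apply/ex; exists (g x).
Qed.

Lemma acyclic_cores (P : lmodType S -> Prop) M (X : resolution M) m k N :
  projective_terms X -> (forall B, P B -> forall i, (m < i)%N -> acyclic X i B) ->
  cores P k N -> forall i, (m + k < i)%N -> acyclic X i N.
Proof.
move=> projX acP; elim: k N => [|k IHk] N /=.
  by rewrite addn0; apply: acP.
move=> [B [C [sNBC PB cC]]] [|[|i]]; rewrite addnS // ltnS => mki.
apply: (acyclic_sub projX sNBC); first exact: (IHk C).
by apply: acP => //; apply: leq_ltn_trans (leqW mki); rewrite leq_addr.
Qed.

(** * Direct summands of sums of copies of [T] *)

Definition add_closure T M : Prop := exists I : Type, retract M (dsum I T).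

(** Only the retraction is kept: retracts compose and pass to direct sums without naming a
    complement. *)
Lemma Add_closure T M : Add T M -> add_closure T M.
Proof.
move=> [I [N [f bijf]]]; exists I; have injf := bij_inj bijf.
have [g _ fK] := bijf.
have [|h hE] := corestriction (g := idfun) injf.
  by move=> x; exists (g x); rewrite fK.
have inL : linear (fun m : M => (m, 0 : N)).
  by move=> a x y; congr (_, _); rewrite /= scaler0 addr0.
exists (f \o pack_linear inL), (fst \o h) => x.
rewrite /= (_ : h _ = (x, 0)) //; apply: injf; exact: hE.
Qed.

Lemma add_closure_retract T A B :
  retract A B -> add_closure T B -> add_closure T A.
Proof. by move=> rAB [I rB]; exists I; apply: retract_trans rB. Qed.

(** The retraction onto [C] is lifted on each copy of [T] separately; the lifts assemble on the
    direct sum and restrict to [C]. *)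
Lemma add_closure_lift T (X : resolution T) A B C (j : {linear A -> B})
    (p : {linear B -> C}) : projective_terms X -> injective j ->
  (forall c, exists b, p b = c) -> exact_at j p -> acyclic X 1 A ->
  add_closure T C -> exists s : {linear C -> B}, forall c, p (s c) = c.
Proof.
move=> projX injj surjp ex acA [I [u [v vu]]].
have v_delta_linear i : linear (fun t => v (dsum_delta i t)).
  by move=> a x y; rewrite dsum_delta_linear linearP.
have /choice[g gE] : forall i, exists g : {linear T -> B},
    forall t, p (g t) = v (dsum_delta i t).
  by move=> i; have := acyclic_lift projX injj surjp ex acA (pack_linear (v_delta_linear i)).
have [h hE] := dsum_copair g.
exists (h \o u) => c; rewrite -[RHS]vu.
apply: (dsum_linear_ext (f := p \o h) (g := v)) => i a.
by rewrite /= hE gE.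
Qed.

Lemma cores_shorten T (X : resolution T) q k N : projective_terms X ->
  (forall B, add_closure T B -> forall j, (0 < j)%N -> acyclic X j B) ->
  (forall j, (q < j)%N -> acyclic X j N) -> cores (add_closure T) k N ->
  exists2 k', (k' <= q)%N & cores (add_closure T) k' N.
Proof.
move=> projX acT; elim: k q N => [|k IHk] q N acN /=; first by exists 0%N.
move=> [B [C [sNBC TB cC]]].
(* Passing to the cokernel lowers the bound by one; for [q = 0] it stays 0, and positive degrees
   still shift. *)
have acC j : (q.-1 < j)%N -> acyclic X j C.
  case: j => // j qj; apply: (acyclic_quotient projX sNBC); first exact: acT.
  by apply: acN; case: (q) qj.
have [k' k'q cC'] := IHk q.-1 C acC cC.
case: q acN acC k'q => [|q] acN acC k'q; last first.
  by exists k'.+1 => //=; exists B, C.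
(* With [q = 0] the cokernel [C] is itself a summand of copies of [T]; Ext^1(T, N) = 0 splits the
   sequence, so [N] is a summand of [B]. *)
move: k'q cC'; rewrite leqn0 => /eqP-> /= TC.
exists 0%N => //=; case: sNBC => j [p [injj surjp ex]].
have [s sE] := add_closure_lift projX injj surjp ex (acN 1%N isT) TC.
exact: add_closure_retract (ses_retract injj ex sE) TB.
Qed.

(** * Projective modules, syzygies and splicing *)

Lemma projective_retract_free F : projective F -> retract F (dsum F (S^o)).
Proof.
move=> projF.
have scale_linear (x : F) : linear (fun s : S^o => (s : S) *: x).
  by move=> a s t; rewrite scalerDl scalerA.
have [p pE] := dsum_copair (fun x => pack_linear (scale_linear x)).
have [|u uE] := projF _ _ p idfun.
  by move=> x; exists (dsum_delta x (1 : S^o)); rewrite pE /= scale1r.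
by exists u, p.
Qed.

Lemma projective_retract A B : retract A B -> projective B -> projective A.
Proof.
move=> [u [v vu]] projB C D g f surjg.
have [h hE] := projB C D g (f \o v) surjg.
by exists (h \o u) => x; rewrite /= hE /= vu.
Qed.

(** [Y] is [X] shifted by one degree, with augmentation [q]. Hom into [N] gives the same maps for
    both, which is the dimension shift in the last clause. *)
Lemma syzygy M (X : resolution M) :
  exists (K : lmodType S) (j : {linear K -> X 0%N}) (Y : resolution K)
    (q : {linear X 1%N -> K}),
  [/\ injective j, exact_at j (res_aug X), forall x, j (q x) = res_diff X 0%N x
    & [/\ forall Q : lmodType S -> Prop, (forall i, Q (X i)) -> forall i, Q (Y i),
       forall d, vanishes_above d X -> vanishes_above d.-1 Y
     & forall i N, acyclic X i.+2 N -> acyclic Y i.+1 N]].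
Proof.
have [] := @submoduleE S (X 0%N) (fun x => res_aug X x = 0).
- exact: linear0.
- by move=> a x y x0 y0; rewrite linearP x0 y0 scaler0 addr0.
move=> K KE; pose j := submod_incl K.
have ex : exact_at j (res_aug X) by move=> x; rewrite -submod_inclP KE.
have injj : injective j by apply: submod_incl_inj.
have [|q qE] := corestriction (g := res_diff X 0%N) injj.
  by move=> x; apply/ex/res_exact0; exists x.
have surjq k : exists x, q x = k.
  have /res_exact0[x xE] : res_aug X (j k) = 0 by apply/ex; exists k.
  by exists x; apply: injj; rewrite qE.
have exq x : q x = 0 <-> exists y, res_diff X 1%N y = x.
  rewrite -res_exactS -qE; split=> [->|e]; first exact: linear0.
  by apply: injj; rewrite e linear0.
pose Y := @Resolution S (submod_type K) (fun i => X i.+1)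
  (fun i => res_diff X i.+1) q surjq exq (fun i => @res_exactS _ _ X i.+1).
exists (submod_type K), j, Y, q; split=> //; split.
- by move=> Q QX i; apply: (QX i.+1).
- by move=> [|d] vX i di; apply: (vX i.+1).
- by move=> i N acX f fd; apply: acX.
Qed.

(** The bound on [Y] reads [d <= i], so that [d = 0] covers a resolution [Y] that is zero
    throughout. *)
Lemma resolution_splice (K : lmodType S) B M (j : {linear K -> B}) (p : {linear B -> M})
    (Y : resolution K) :
  injective j -> (forall m, exists b, p b = m) -> exact_at j p ->
  exists X : resolution M,
    (projective B -> projective_terms Y -> projective_terms X) /\
    (forall d, (forall i, (d <= i)%N -> zero_module (Y i)) -> vanishes_above d X).
Proof.
move=> injj surjp ex.
pose X i : lmodType S := if i is i'.+1 then Y i' else B.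
pose d i : {linear X i.+1 -> X i} :=
  match i return {linear X i.+1 -> X i} with
  | 0 => j \o res_aug Y
  | i'.+1 => res_diff Y i'
  end.
have ex0 x : p x = 0 <-> exists y, d 0%N y = x.
  rewrite ex; split=> [[k <-]|[y <-]]; last by exists (res_aug Y y).
  by have [y <-] := res_aug_surj Y k; exists y.
have exS i x : d i x = 0 <-> exists y, d i.+1 y = x.
  case: i x => [|i] x; last exact: res_exactS.
  change (j (res_aug Y x) = 0 <-> exists y, res_diff Y 0%N y = x).
  rewrite -res_exact0.
  split=> [e|->]; last exact: linear0.
  by apply: injj; rewrite e linear0.
exists (@Resolution S M X d p surjp ex0 exS); split.
- by move=> projB projY [|i] //=; apply: projY.
- by move=> e vY [|i] //= ei; apply: vY.
Qed.

Definition zero_mod : lmodType S := dsum Empty_set (S^o).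

Lemma zero_modP : zero_module zero_mod.
Proof. by move=> x; apply: dsum_ext => -[]. Qed.

Lemma projective_resolution0 M : projective M ->
  exists2 X : resolution M, projective_terms X & vanishes_above 0 X.
Proof.
move=> projM.
have ex0 (x : zero_mod) : (\0 : {linear zero_mod -> zero_mod}) x = 0 <->
    exists y, (\0 : {linear zero_mod -> zero_mod}) y = x.
  by rewrite [x]zero_modP; split=> // _; exists 0.
have surj0 (x : zero_mod) : exists y, (\0 : {linear zero_mod -> zero_mod}) y = x.
  by exists 0; rewrite [x]zero_modP.
pose Y := @Resolution S zero_mod (fun _ => zero_mod) (fun _ => \0) \0 surj0
  ex0 (fun _ => ex0).
have projY : projective_terms Y.
  move=> i A B g f _; exists \0 => x.
  by rewrite [x]zero_modP !linear0.
have [|||X [projX vX]] := @resolution_splice zero_mod M M \0 idfun Y.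
- by move=> x y _; rewrite [x]zero_modP [y]zero_modP.
- by move=> m; exists m.
- by move=> x; split=> [/= ->|[a <-] //]; exists 0.
exists X; first exact: projX.
by apply: vX => i _; apply: zero_modP.
Qed.

End Cohomology.

(** * Projective dimension detected by Ext into projectives *)

Section ProjectiveDimension.
Variable S : pzRingType.
Implicit Types M N : lmodType S.

Lemma einf_mem A n : einf A = Some n -> A n.
Proof.
rewrite /einf; case: pselect => // exA [<-].
by case: ex_minnP => m /asboolP.
Qed.

Lemma einf_ge A n : A n -> ele (einf A) (Some n).
Proof.
rewrite /einf => An; case: pselect => [exA|no]; last first.
  by case: no; exists n; apply/asboolP.
by case: ex_minnP => m _ /(_ n); apply; apply/asboolP.
Qed.

Lemma acyclic_projective_module M (X : resolution M) d :
  projective_terms X -> vanishes_above d X ->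
  (forall F, projective F -> forall i, acyclic X i.+1 F) -> projective M.
Proof.
elim: d M X => [|d IHd] M X projX vX acX;
  have [K [j [Y [q [injj ex qE [YX vY acY]]]]]] := syzygy X.
  (* As [X 1] is zero, so is the kernel of the augmentation, and [M] is isomorphic to [X 0]. *)
  have j0 k : j k = 0.
    have /ex/res_exact0[y <-] : exists k', j k' = j k by exists k.
    by rewrite (vX 1%N isT y) linear0.
  have [|s sE] := factor_surjection (g := idfun) (@res_aug_surj _ _ X).
    by move=> b /ex[k <-]; apply: j0.
  apply: projective_retract (projX 0%N); exists s, (res_aug X) => m.
  by have [x <-] := res_aug_surj X m; rewrite sE.
have projK : projective K.
  apply: (IHd K Y (YX _ projX) (vY _ vX)) => F projF i.
  by apply: acY; apply: acX.
(* [q] is a cocycle with values in [K]; writing it as a coboundary yields a retraction [r] of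
   [j]. *)
have [|r rE] := acX K projK 0%N q.
  by move=> y; apply: injj; rewrite qE linear0 res_diffK.
have rj k : r (j k) = k.
  have /ex/res_exact0[y yE] : exists k', j k' = j k by exists k.
  by rewrite -yE -rE; apply: injj; rewrite qE.
have [|s sE] := factor_surjection (g := idfun \- (j \o r)) (@res_aug_surj _ _ X).
  by move=> b /ex[k <-]; rewrite /= rj subrr.
apply: projective_retract (projX 0%N); exists s, (res_aug X) => m.
have [x <-] := res_aug_surj X m; rewrite sE linearB /=.
suff -> : res_aug X (j (r x)) = 0 by rewrite subr0.
by apply/ex; exists (r x).
Qed.

(** Each syzygy lowers [e] by one until a projective module is reached; [X 0] is then spliced back
    on. *)
Lemma acyclic_resolution M (X : resolution M) d e :
  projective_terms X -> vanishes_above d X ->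
  (forall F, projective F -> forall i, (e < i)%N -> acyclic X i F) ->
  exists2 Y : resolution M, projective_terms Y & vanishes_above e Y.
Proof.
elim: e d M X => [|e IHe] d M X projX vX acX.
  apply: projective_resolution0; apply: (acyclic_projective_module projX vX).
  by move=> F projF i; apply: acX.
have [K [j [Y [q [injj ex qE [YX vY acY]]]]]] := syzygy X.
have [|Z projZ vZ] := IHe d.-1 K Y (YX _ projX) (vY _ vX).
  by move=> F projF [|i] // ei; apply: acY; apply: acX.
have [W [projW vW]] := resolution_splice Z injj (@res_aug_surj _ _ X) ex.
by exists W; [exact: projW | exact: vW].
Qed.

End ProjectiveDimension.

(** * The bound on the finitistic dimension *)

Theorem corollary4p7 (R : pzRingType) (T : rmodType R)
    (hR : right_noetherian R) (hT : tilting T) :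
  ele (findim R^c) (eadd (pd T) (id_dim T)).
Proof.
case: hT => + T2 [k [C [vC AddC]]].
case pdT: (pd T) => [n|] // _; case idT: (id_dim T) => [m|]; last by case: findim.
have [X [projX vX]] := einf_mem pdT.
have [E [injE vE]] := einf_mem idT.
have idT_cores : cores (@injective_module R^c) m T.
  by apply: (coresolution_cores (@injective_retract _)) vE => i _.
have coresR : cores (add_closure T) k (R^c)^o.
  apply: (coresolution_cores (@add_closure_retract _ T)) vC => i ik.
  exact/Add_closure/AddC.
have {k C vC AddC coresR} [k kn coresR] : exists2 k, (k <= n)%N &
    cores (add_closure T) k (R^c)^o.
  apply: (cores_shorten projX) coresR => [B [I rB] [|j] // _|j nj f _].
    by apply: acyclic_retract rB _; apply: T2.
  case: j nj f => // j nj f; exists \0 => x.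
  by rewrite (vX _ nj x) !linear0.
apply: einf_ge => _ [M pdM ->]; case pdM': (pd M) pdM => [d|] // _.
have [Y [projY vY]] := einf_mem pdM'.
have acF F : projective F -> forall i, (m + n < i)%N -> acyclic Y i F.
  move=> /projective_retract_free rF [|i] // mni.
  apply: acyclic_retract rF _.
  (* Two shifts add up: injective coresolutions of length [m] put sums of copies of [T] in [P], and
     the coresolution of the free module costs [k <= n] more degrees. *)
  pose P (B : rmodType R) := forall i, (m < i)%N -> acyclic Y i B.
  have injP (B : rmodType R) : cores (@injective_module R^c) m B -> P B.
    move=> cB i' mi'; apply: (acyclic_cores (m := 0) projY _ cB) => // B' injB'.
    by case=> // i'' _; apply: acyclic_injective.
  apply: (acyclic_cores (P := P) (k := k) (m := m) projY) => //; last first.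
    by apply: leq_ltn_trans mni; rewrite leq_add2l.
  apply: cores_dsum coresR => B [I rB] [|i'] // mi'.
  apply: acyclic_retract (retract_dsum F rB) _; apply: injP mi'.
  (* One direct sum comes from [add_closure], the other from the free module on [F]. *)
  do 2!apply: (cores_dsum (fun _ => injective_dsum hR)).
  exact: idT_cores.
rewrite addnC; have [Z projZ vZ] := acyclic_resolution projY vY acF.
by rewrite -pdM'; apply: einf_ge; exists Z.
Qed.
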